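(* Subsumption of acyclic typed feature structures is well-founded; that is, there exists no infinite decreasing sequence $A_0\sqsupset A_1\sqsupset A_2\sqsupset\cdots$ of acyclic typed feature structures.
   Context: Fix non-empty, finite, disjoint sets $\mathrm{FEATS}$ (features, totally ordered) and $\mathrm{TYPES}$ (types). $\mathrm{TYPES}$ carries a partial order $\sqsubseteq$ that is bounded complete (every subset having an upper bound has a unique least upper bound), with least element $\bot$ and greatest element $\top$. Fix an infinite set $\mathrm{NODES}$, disjoint from these, with a typing function $\theta:\mathrm{NODES}\to\mathrm{TYPES}$ such that $\{q\in\mathrm{NODES}\mid\theta(q)=t\}$ is infinite for every type $t$. A typed feature structure (TFS) is a triple $A=(Q,\bar q,\delta)$ where $Q\subseteq\mathrm{NODES}$ is finite and non-empty, $\bar q\in Q$ is the root, and $\delta:Q\times\mathrm{FEATS}\to Q$ is a partial function such that every node of $Q$ is accessible from $\bar q$ via $\delta$. $\delta$ is extended to paths (finite sequences of features) by $\delta(q,\epsilon)=q$ and $\delta(q,f\pi)=\delta(\delta(q,f),\pi)$, where $\epsilon$ is the empty path. $A$ is cyclic if there are a non-empty path $\alpha$ and a node $q\in Q$ with $\delta(q,\alpha)=q$; otherwise it is acyclic. A TFS $A_1=(Q_1,\bar q_1,\delta_1)$ subsumes $A_2=(Q_2,\bar q_2,\delta_2)$, written $A_1\sqsubseteq A_2$, iff there is a total function $h:Q_1\to Q_2$ with (i) $h(\bar q_1)=\bar q_2$; (ii) $\theta(q)\sqsubseteq\theta(h(q))$ for all $q\in Q_1$; (iii) for every $q\in Q_1$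 and every feature $f$ such that $\delta_1(q,f)$ is defined, $\delta_2(h(q),f)$ is defined and $h(\delta_1(q,f))=\delta_2(h(q),f)$. $A\sqsubset B$ (equivalently $B\sqsupset A$) means $A\sqsubseteq B$ and $A\neq B$. An order $\succ$ on a set $D$ is well-founded iff there exists no infinite decreasing sequence $d_0\succ d_1\succ d_2\succ\cdots$ of elements of $D$; here $\succ$ is $\sqsupset$ on the collection of acyclic TFSs.
   Formalization: Strict subsumption is read as subsumption between structures that are not equal up to renaming of nodes (type-preserving isomorphism); with literal inequality the claim fails, since two one-node structures on distinct nodes of the same type subsume each other and alternate forever. *)

(* Defs.v *)
From mathcomp Require Export all_boot all_order finmap.
From mathcomp Require Export boolp classical_sets cardinality.

Set Implicit Arguments.
Unset Strict Implicit.
Unset Printing Implicit Defensive.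

Import Order.TTheory.

Definition bounded_complete d (T : porderType d) : Prop :=
  forall S : set T, has_ubound S -> exists! u : T, supremums S u.

Section Paths.
Variables (FEATS Q : Type) (delta : Q -> FEATS -> option Q).

Fixpoint delta_path (q : Q) (p : seq FEATS) : option Q :=
  if p is f :: p' then
    if delta q f is Some q' then delta_path q' p' else None
  else Some q.

End Paths.

(* [delta A q f = None] means that delta is undefined at (q, f); the set of
   nodes is non-empty because it contains the root. *)
Record tfs (FEATS : Type) (NODES : choiceType) := TFS {
  nodes : {fset NODES};
  root : nodes;
  delta : nodes -> FEATS -> option nodes;
  accessible : forall q : nodes, exists p, delta_path delta root p = Some q
}.

Section TFS.
Context {dT : Order.disp_t} {FEATS : Type} {TYPES : porderType dT}
  {NODES : choiceType}.
Variable theta : NODES -> TYPES.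
Implicit Types A B : tfs FEATS NODES.

Definition cyclic A : Prop :=
  exists (p : seq FEATS) (q : nodes A),
    p <> [::] /\ delta_path (@delta _ _ A) q p = Some q.

Definition acyclic A : Prop := ~ cyclic A.

Definition subsumes A B : Prop :=
  exists h : nodes A -> nodes B,
    [/\ h (root A) = root B,
        forall q, (theta (val q) <= theta (val (h q)))%O
      & forall q f q', delta q f = Some q' -> delta (h q) f = Some (h q')].

Definition same_up_to_renaming A B : Prop :=
  exists h : nodes A -> nodes B,
    [/\ bijective h,
        h (root A) = root B,
        forall q, theta (val q) = theta (val (h q))
      & forall q f, delta (h q) f = omap h (delta q f)].

(* Distinctness has to be read up to the identity of the nodes: two distinct
   one-node structures whose nodes have the same type subsume each other, so
   with literal inequality of triples strict subsumption would not even be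
   antisymmetric, and alternating between them would descend forever. *)
Definition strictly_subsumes A B : Prop :=
  subsumes A B /\ ~ same_up_to_renaming A B.

End TFS.

(* Main.v *)
Require Import Defs.

Set Implicit Arguments.
Unset Strict Implicit.
Unset Printing Implicit Defensive.

(** The chain only ever moves to more general structures, so every path defined
    in some [A i] is already defined in [A 0], which is acyclic: all these paths
    have length at most [N := #|nodes (A 0)|]. A structure whose paths have
    length at most [N] is determined up to renaming by the finite set of true
    facts of the form: path [p] leads to a node of type at least [t], or paths
    [p] and [p'] lead to the same node. This set shrinks strictly along the
    chain. *)

Import Order.TTheory.

Local Open Scope classical_set_scope.

Lemma delta_path_cat (FEATS Q : Type) (delta : Q -> FEATS -> option Q)
    (q : Q) (p1 p2 : seq FEATS) :
  delta_path delta q (p1 ++ p2) =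
  obind (fun r => delta_path delta r p2) (delta_path delta q p1).
Proof.
by elim: p1 q => [|f p1 IH] q //=; case: (delta q f) => [r|] //=.
Qed.

Section PathCode.
Context {dT : Order.disp_t} {FEATS : finType} {TYPES : finTBPOrderType dT}
  {NODES : choiceType}.
Variable theta : NODES -> TYPES.
Implicit Types A B : tfs FEATS NODES.

Local Notation dpath A p := (delta_path (@delta _ _ A) (root A) p).

Definition paths_bounded (N : nat) A : Prop :=
  forall p, isSome (dpath A p) -> (size p <= N)%N.

(** Pigeonhole: a defined path longer than the number of nodes has two proper prefixes reaching the
    same node, and the segment between them is a cycle. *)
Lemma acyclic_paths_bounded A : acyclic A -> paths_bounded #|{: nodes A}| A.
Proof.
move=> acA p; case Ep: (dpath A p) => [q|//] _.
rewrite leqNgt; apply/negP=> ltp.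
have defp (i : nat) : dpath A (take i p).
  move: Ep; rewrite -{1}(cat_take_drop i p) delta_path_cat.
  by case: (dpath A _).
(* The default [root A] is never taken, by [defp]. *)
pose f (i : 'I_(size p)) := odflt (root A) (dpath A (take i p)).
have fE i : dpath A (take (nat_of_ord i) p) = Some (f i).
  by rewrite /f; move: (defp i); case: (dpath A _).
have ninj : ~ injective f.
  by move/leq_card; rewrite card_ord leqNgt ltp.
apply: ninj => i j fij; apply: contrapT => nij; apply: acA.
wlog ltij : i j fij nij / (i < j)%N.
  move=> W; case: (ltngtP i j) => [|ltji|/ord_inj //]; first exact: W.
  by apply: (W j i) => // ji; apply: nij.
(* The cycle is the segment of [p] from position [i] to position [j]. *)
exists (drop i (take j p)), (f i); split.
  move/(congr1 size); rewrite size_drop size_takel 1?ltnW //=.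
  by move/eqP; rewrite subn_eq0 leqNgt ltij.
have := fE j; rewrite -{1}(cat_take_drop i (take j p)) take_takel 1?ltnW //.
by rewrite delta_path_cat fE /= -fij.
Qed.

Section Morphism.
Variables (A B : tfs FEATS NODES) (h : nodes A -> nodes B).
Hypothesis h_root : h (root A) = root B.
Hypothesis h_delta :
  forall q f q', delta q f = Some q' -> delta (h q) f = Some (h q').

Lemma morphism_delta_path p q : dpath A p = Some q -> dpath B p = Some (h q).
Proof.
rewrite -h_root; elim: p (root A) => [|f p IH] r /=; first by case=> ->.
by case E: (delta r f) => [s|//]; rewrite (h_delta E); apply: IH.
Qed.

End Morphism.

Lemma subsumes_paths_bounded N A B :
  subsumes theta A B -> paths_bounded N B -> paths_bounded N A.
Proof.
move=> [h [hr _ hd]] bB p; case Ep: (dpath A p) => [q|//] _.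
by apply: bB; rewrite (morphism_delta_path hr hd Ep).
Qed.

(** Bounded sequences make the ambient type finite. Recording lower bounds of types, not the types
    themselves, makes the code monotone under subsumption. *)
Definition path_code (N : nat) A :
    {set N.-bseq FEATS * (TYPES + N.-bseq FEATS)} :=
  [set x : N.-bseq FEATS * (TYPES + N.-bseq FEATS) |
   if dpath A x.1 is Some q then
     match x.2 with
     | inl t => (t <= theta (val q))%O
     | inr p => dpath A p == Some q
     end
   else false]%SET.

Lemma path_code_subset N A B :
  subsumes theta A B -> path_code N A \subset path_code N B.
Proof.
move=> [h [hr ht hd]]; apply/fintype.subsetP=> -[p x]; rewrite !inE /=.
case Ep: (dpath A p) => [q|//]; rewrite (morphism_delta_path hr hd Ep).
case: x => [t /le_trans|p' /eqP Ep']; first by apply; apply: ht.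
by rewrite (morphism_delta_path hr hd Ep').
Qed.

(** The subsumption map [h] is itself the renaming: by the bound, every path of [B] fits in the
    code, so facts true in [B] can be pulled back to [A]. *)
Lemma path_code_eq N A B : paths_bounded N B -> subsumes theta A B ->
  path_code N A = path_code N B -> same_up_to_renaming theta A B.
Proof.
move=> bB [h [hr ht hd]] eqc.
have hP p q := @morphism_delta_path A B h hr hd p q.
have defA p r : dpath B p = Some r -> exists2 q, dpath A p = Some q & h q = r.
  move=> Ep; have szp : (size p <= N)%N by apply: bB; rewrite Ep.
  (* With the bound [\bot], the fact only says that [p] is defined. *)
  have : (Bseq szp, inl \bot%O) \in path_code N B.
    by rewrite inE /= Ep le0x.
  rewrite -eqc inE /=; case EA: (dpath A p) => [q|//] _; exists q => //.
  by move: Ep; rewrite (hP _ _ EA) => -[].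
have hinj : injective h.
  move=> q q' hq; have [p Ep] := accessible q; have [p' Ep'] := accessible q'.
  have szp : (size p <= N)%N by apply: bB; rewrite (hP _ _ Ep).
  have szp' : (size p' <= N)%N by apply: bB; rewrite (hP _ _ Ep').
  (* Paths to [q] and [q'] meet in [B], hence already in [A]. *)
  have : (Bseq szp, inr (Bseq szp')) \in path_code N B.
    by rewrite inE /= (hP _ _ Ep) (hP _ _ Ep') hq.
  by rewrite -eqc inE /= Ep Ep' => /eqP[].
have hsurj r : exists q, h q = r.
  by have [p Ep] := accessible r; have [q _ <-] := defA _ _ Ep; exists q.
exists h; split=> //.
- have [g hg] := choice hsurj.
  by exists g => // q; apply: hinj.
- move=> q; apply: le_anti; rewrite ht /=; have [p Ep] := accessible q.
  have szp : (size p <= N)%N by apply: bB; rewrite (hP _ _ Ep).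
  (* The sharpest type fact at [h q], pulled back, gives the converse inequality. *)
  have : (Bseq szp, inl (theta (val (h q)))) \in path_code N B.
    by rewrite inE /= (hP _ _ Ep).
  by rewrite -eqc inE /= Ep.
- move=> q f; case E: (delta q f) => [q'|]; first exact: hd.
  case EB: (delta (h q) f) => [r|//]; have [p Ep] := accessible q.
  (* A feature defined at [h q] extends a path to [q], and the extended path must be defined in [A]
     too. *)
  have /defA[s] : dpath B (p ++ [:: f]) = Some r.
    by rewrite delta_path_cat (hP _ _ Ep) /= EB.
  by rewrite delta_path_cat Ep /= E.
Qed.

Lemma strictly_subsumes_card_path_code N A B : paths_bounded N B ->
  strictly_subsumes theta A B -> (#|path_code N A| < #|path_code N B|)%N.
Proof.
move=> bB [sAB nAB]; apply: proper_card.
rewrite finset.properEneq path_code_subset // andbT; apply/eqP=> eqc.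
exact/nAB/(path_code_eq bB).
Qed.

End PathCode.

Theorem theorem2p3p6 (dF dT : Order.disp_t)
    (FEATS : finOrderType dF) (TYPES : finTBPOrderType dT)
    (NODES : choiceType) (theta : NODES -> TYPES)
    (FEATS_nonempty : (0 < #|FEATS|)%N)
    (TYPES_bounded_complete : bounded_complete TYPES)
    (NODES_infinite : infinite_set [set: NODES])
    (theta_infinite : forall t : TYPES, infinite_set [set q | theta q = t]) :
  ~ exists A : nat -> tfs FEATS NODES,
      (forall i, acyclic (A i)) /\
      (forall i, strictly_subsumes theta (A i.+1) (A i)).
Proof.
move=> [A [acA ssA]]; pose N := #|{: nodes (A 0%N)}|.
have bA i : paths_bounded N (A i).
  elim: i => [|i]; first exact/acyclic_paths_bounded.
  by have [/subsumes_paths_bounded + _] := ssA i; apply.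
pose c i := #|path_code theta N (A i)|.
(* Each step loses at least one fact, which is impossible for [c 0 + 1] steps. *)
have leq_c i : (i + c i <= c 0)%N.
  elim: i => [|i IH] //; apply: leq_trans IH; rewrite addSnnS leq_add2l.
  exact: strictly_subsumes_card_path_code.
by have := leq_trans (leq_addr _ _) (leq_c (c 0%N).+1); rewrite ltnn.
Qed.
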